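(* The matrix $$A_{243}:=\begin{pmatrix}0&10&-4\\ 10&9&-6\\ 4&2&-9\end{pmatrix}$$ has $9$ distinct regular Pareto eigenvalues and admits an assigned support map with detailed profile $(1,1,0;1,2,1;3)$.
   Context: Vector inequalities are componentwise ($u>0$ means all components are positive). For $A\in\mathbb{R}^{n\times n}$, a real number $\lambda$ is a Pareto eigenvalue of $A$ if there is $x\in\mathbb{R}^n\setminus\{0\}$ with $x\ge 0$, $Ax-\lambda x\ge 0$ and $\langle x,Ax-\lambda x\rangle=0$. The set of Pareto eigenvalues is $\Pi(A)$. A support is a nonempty subset $J\subseteq\{1,\dots,n\}$, with complement $J^{\mathrm c}$; $A_J$ is the principal submatrix indexed by $J$ and $A_{J^{\mathrm c},J}$ is the submatrix with rows in $J^{\mathrm c}$ and columns in $J$. The support $J$ produces $\lambda\in\mathbb{R}$ if there is $u\in\mathbb{R}^{|J|}$ with $A_Ju=\lambda u$, $u>0$, $A_{J^{\mathrm c},J}u\ge 0$. The set of values produced by $J$ is $\Pi_J(A)$; one has $\Pi(A)=\bigcup_J\Pi_J(A)$. A value $\lambda\in\Pi_J(A)$ is regularly produced by $J$ if it is an algebraically simple eigenvalue of $A_J$ and every component of $A_{J^{\mathrm c},J}u$ is positive, where $u$ is the vector above (the second condition is empty if $J=\{1,\dots,n\}$). A Pareto eigenvalue is regular if it is regularly produced by at least one support. An assigned support map for $A$ is a map $\tau$ from $\Pi(A)$ to the set of supports such that $\lambda\in\Pi_{\tau(\lambda)}(A)$ for every $\lambda\in\Pi(A)$. Put $m_J:=|\{\lambda\in\Pi(A):\tau(\lambda)=J\}|$.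 For $n=3$ the detailed (assigned) profile is $(m_1,m_2,m_3;m_{12},m_{13},m_{23};m_{123})$, where $m_i=m_{\{i\}}$, $m_{ij}=m_{\{i,j\}}$, $m_{123}=m_{\{1,2,3\}}$. *)

(* Defs.v *)
From mathcomp Require Import all_boot all_order all_algebra.
From mathcomp Require Import all_classical all_reals.
Set Implicit Arguments.
Unset Strict Implicit.
Unset Printing Implicit Defensive.
Import Order.TTheory GRing.Theory Num.Theory.
Local Open Scope classical_set_scope.
Local Open Scope ring_scope.

Definition nonneg_vec (R : realType) (m : nat) (v : 'cV[R]_m) : Prop :=
  forall i, 0 <= v i 0.

Definition pos_vec (R : realType) (m : nat) (v : 'cV[R]_m) : Prop :=
  forall i, 0 < v i 0.

Definition dotv (R : realType) (m : nat) (v w : 'cV[R]_m) : R :=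
  \sum_i v i 0 * w i 0.

Definition Pareto_eigenvalue (R : realType) (n : nat) (A : 'M[R]_n) (l : R) :
    Prop :=
  exists x : 'cV[R]_n,
    [/\ x != 0, nonneg_vec x, nonneg_vec (A *m x - l *: x)
      & dotv x (A *m x - l *: x) = 0].

Definition Pareto_spectrum (R : realType) (n : nat) (A : 'M[R]_n) : set R :=
  [set l | Pareto_eigenvalue A l].

Definition is_support (n : nat) (J : {set 'I_n}) : Prop := J != finset.set0.

(* Rows in I and columns in J, both listed in increasing order. *)
Definition submx_at (R : realType) (n : nat) (A : 'M[R]_n)
    (I J : {set 'I_n}) : 'M[R]_(#|I|, #|J|) :=
  \matrix_(i < #|I|, j < #|J|) A (enum_val i) (enum_val j).

Definition produces_with (R : realType) (n : nat) (A : 'M[R]_n)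
    (J : {set 'I_n}) (l : R) (u : 'cV[R]_#|J|) : Prop :=
  [/\ is_support J, submx_at A J J *m u = l *: u, pos_vec u
    & nonneg_vec (submx_at A (~: J) J *m u)].

Definition produced_set (R : realType) (n : nat) (A : 'M[R]_n)
    (J : {set 'I_n}) : set R :=
  [set l | exists u : 'cV[R]_#|J|, produces_with A l u].

Definition alg_simple_eigenvalue (R : realType) (m : nat) (B : 'M[R]_m)
    (l : R) : Prop :=
  mup l (char_poly B) = 1%N.

(* Once l is a simple eigenvalue of A_J, the vector u is unique up to a
   positive factor, so it does not matter which one is tested. *)
Definition regularly_produced (R : realType) (n : nat) (A : 'M[R]_n)
    (J : {set 'I_n}) (l : R) : Prop :=
  alg_simple_eigenvalue (submx_at A J J) l /\
  exists u : 'cV[R]_#|J|,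
    produces_with A l u /\ pos_vec (submx_at A (~: J) J *m u).

Definition regular_Pareto_eigenvalue (R : realType) (n : nat) (A : 'M[R]_n)
    (l : R) : Prop :=
  Pareto_eigenvalue A l /\
  exists J : {set 'I_n}, regularly_produced A J l.

(* tau is total on R; only its values on the Pareto spectrum matter. *)
Definition assigned_support_map (R : realType) (n : nat) (A : 'M[R]_n)
    (tau : R -> {set 'I_n}) : Prop :=
  forall l : R, Pareto_spectrum A l ->
    is_support (tau l) /\ produced_set A (tau l) l.

(* m_J = k, as a relation so that no default value is needed for the
   cardinality of an infinite set. *)
Definition support_count (R : realType) (n : nat) (A : 'M[R]_n)
    (tau : R -> {set 'I_n}) (J : {set 'I_n}) (k : nat) : Prop :=
  ([set l | Pareto_spectrum A l /\ tau l = J] #= `I_k)%card.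

(* The indices 1, 2, 3 are the elements 0, 1, 2 of 'I_3. *)
Definition detailed_profile (R : realType) (A : 'M[R]_3)
    (tau : R -> {set 'I_3})
    (m1 m2 m3 m12 m13 m23 m123 : nat) : Prop :=
  let e1 : 'I_3 := 0 in let e2 : 'I_3 := 1 in let e3 : 'I_3 := 2 in
  [/\ [/\ support_count A tau [set e1]%SET m1,
          support_count A tau [set e2]%SET m2
        & support_count A tau [set e3]%SET m3],
      [/\ support_count A tau [set e1; e2]%SET m12,
          support_count A tau [set e1; e3]%SET m13
        & support_count A tau [set e2; e3]%SET m23]
    & support_count A tau [set e1; e2; e3]%SET m123].

Definition A243 (R : realType) : 'M[R]_3 :=
  \matrix_(i < 3, j < 3)
    (nth [::] [:: [:: 0; 10; -4];
                  [:: 10; 9; -6];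
                  [:: 4; 2; -9]] i)`_j.

(* Main.v *)
(* On a vector with support J the Pareto conditions say that l is an eigenvalue
   of A_J together with sign conditions, and for A243 eliminating the vector in
   each of the seven cases leaves one polynomial equation in l:
   {1}: l = 0;  {2}: l = 9;  {3}: impossible, as the entry (1,3) is negative;
   {1,2}: l^2 - 9 l - 100 = 0, with l > 0;  {1,3}: l^2 + 9 l + 16 = 0;
   {2,3}: l^2 = 69, with l >= -6;  {1,2,3}: l^3 - 153 l - 724 = 0.
   Sign changes locate the admissible roots in nine disjoint rational intervals,
   which are fine enough to make all the sign conditions strict.  Each A_J has
   |J| distinct real eigenvalues, so all of them are algebraically simple. *)
Require Import Defs.
From mathcomp Require Import all_boot all_order all_algebra.
From mathcomp Require Import all_classical all_reals.
From mathcomp Require Import finmap ring lra.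
Import Order.TTheory GRing.Theory Num.Theory.
Set Implicit Arguments.
Unset Strict Implicit.
Unset Printing Implicit Defensive.
Local Open Scope classical_set_scope.
Local Open Scope ring_scope.

(** * Cardinality of lists and roots of characteristic polynomials *)

Lemma card_eq_uniq_seq (T : choiceType) (s : seq T) :
  uniq s -> ([set x | x \in s] #= `I_(size s))%card.
Proof.
move=> us; have -> : [set x | x \in s] = [set` [fset x in s]%fset].
  by apply/seteqP; split => x /=; rewrite inE.
by apply/card_eq_fsetP; rewrite [LHS]card_fseq undup_id.
Qed.

Lemma char_poly_trmx (R : comNzRingType) (n : nat) (B : 'M[R]_n) :
  char_poly B^T = char_poly B.
Proof.
rewrite /char_poly -[RHS]det_tr; congr (\det _).
by apply/matrixP => i j; rewrite !mxE eq_sym.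
Qed.

(** [eigenvalue] is stated for row vectors, so the column is transposed; this leaves the
    characteristic polynomial unchanged. *)
Lemma root_char_poly_col (F : fieldType) (n : nat) (B : 'M[F]_n) (l : F)
    (v : 'cV[F]_n) : v != 0 -> B *m v = l *: v -> root (char_poly B) l.
Proof.
move=> v0 Bv; rewrite -char_poly_trmx -eigenvalue_root_char.
apply/eigenvalueP; exists v^T; last by rewrite trmx_eq0.
by rewrite -trmx_mul Bv linearZ.
Qed.

(** * Eigenvectors of principal submatrices, extended by zero *)

Definition restrict (R : realType) (n : nat) (J : {set 'I_n}) (x : 'cV[R]_n) :
    'cV[R]_#|J| := \col_j x (enum_val j) 0.

(** Keeping the eigenvector of [A_J] in full dimension lets sign conditions refer to plain
    coordinates instead of [enum_val]. *)
Definition supported_eigenvector (R : realType) (n : nat) (A : 'M[R]_n)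
    (J : {set 'I_n}) (l : R) (x : 'cV[R]_n) : Prop :=
  (forall i, i \notin J -> x i 0 = 0) /\
  (forall i, i \in J -> (A *m x) i 0 = l * x i 0).

Section Restriction.
Variables (R : realType) (n : nat) (A : 'M[R]_n).
Implicit Types (I J : {set 'I_n}) (x : 'cV[R]_n).

Lemma submx_at_mul_restrict I J x : (forall i, i \notin J -> x i 0 = 0) ->
  submx_at A I J *m restrict J x = restrict I (A *m x).
Proof.
move=> xJ; apply/matrixP => i j; rewrite (ord1 j) !mxE.
rewrite (bigID (mem J)) /= [X in _ + X]big1 => [|k kJ]; last first.
  by rewrite xJ// mulr0.
rewrite addr0 [RHS]big_enum_val/=.
by apply: eq_bigr => k _; rewrite !mxE.
Qed.

Lemma submx_at_eigenvector J l x : supported_eigenvector A J l x ->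
  submx_at A J J *m restrict J x = l *: restrict J x.
Proof.
move=> [xJ Ax]; rewrite submx_at_mul_restrict//.
by apply/matrixP => i j; rewrite !mxE -Ax ?enum_valP// mxE.
Qed.

(* The eigenvectors of A_J need not be positive here: #|J| distinct
   eigenvalues split the characteristic polynomial, so all are simple. *)
Lemma alg_simple_eigenvalue_uniq J (s : seq R) (l : R) :
  uniq s -> size s = #|J| ->
  (forall m, m \in s ->
     exists x, supported_eigenvector A J m x /\
       exists2 i, i \in J & x i 0 != 0) ->
  l \in s -> alg_simple_eigenvalue (submx_at A J J) l.
Proof.
move=> us sJ eig ls; rewrite /alg_simple_eigenvalue.
have rs : all (root (char_poly (submx_at A J J))) s.
  apply/allP => m /eig[x [xm [i iJ xi]]].
  apply: root_char_poly_col (submx_at_eigenvector xm).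
  apply: contra_neq xi => /matrixP/(_ (enum_rank_in iJ i) 0).
  by rewrite !mxE enum_rankK_in.
rewrite (all_roots_prod_XsubC _ rs) ?size_char_poly ?sJ ?uniq_rootsE//.
rewrite (monicP (char_poly_monic _)) scale1r mu_prod_XsubC.
by rewrite count_uniq_mem// ls.
Qed.

Lemma produced_regular J l x : is_support J ->
  alg_simple_eigenvalue (submx_at A J J) l ->
  supported_eigenvector A J l x -> (forall i, i \in J -> 0 < x i 0) ->
  (forall i, i \notin J -> 0 < (A *m x) i 0) ->
  regularly_produced A J l.
Proof.
move=> J0 ls xl xJ xJc; split => //; exists (restrict J x).
have pJc : pos_vec (submx_at A (~: J) J *m restrict J x).
  move=> i; rewrite submx_at_mul_restrict ?mxE//; last exact: xl.1.
  have := enum_valP i; rewrite inE => /xJc.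
  by rewrite mxE.
split => //; split => //.
- exact: submx_at_eigenvector.
- by move=> i; rewrite mxE xJ// enum_valP.
- by move=> i; exact/ltW.
Qed.

(** Complementarity holds index by index: the residual vanishes on [J], and [x] vanishes off [J]. *)
Lemma Pareto_of_supported J l x : is_support J ->
  supported_eigenvector A J l x -> (forall i, i \in J -> 0 < x i 0) ->
  (forall i, i \notin J -> 0 < (A *m x) i 0) ->
  Pareto_eigenvalue A l.
Proof.
move=> /set0Pn[k kJ] [xJc Ax] xJ AxJc; exists x; split.
- by apply: contraTneq (xJ _ kJ) => ->; rewrite mxE ltxx.
- by move=> i; have [/xJ/ltW//|/xJc->] := boolP (i \in J).
- move=> i; rewrite mxE [X in _ + X]mxE [X in _ - X]mxE.
  have [/Ax->|iJ] := boolP (i \in J); first by rewrite subrr.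
  by rewrite (xJc _ iJ) mulr0 subr0 ltW// AxJc.
- rewrite /dotv big1// => i _; rewrite mxE [X in _ * (_ + X)]mxE.
  rewrite [X in _ - X]mxE; have [/Ax->|iJ] := boolP (i \in J).
    by rewrite subrr mulr0.
  by rewrite (xJc _ iJ) mul0r.
Qed.

End Restriction.

(** * The matrix in coordinates and the equations its Pareto eigenvalues satisfy *)

Definition vec3 (R : realType) (x y z : R) : 'cV[R]_3 :=
  \col_(i < 3) [:: x; y; z]`_i.

Lemma ord3P (P : 'I_3 -> Prop) : P 0 -> P 1 -> P 2 -> forall i, P i.
Proof.
move=> P0 P1 P2 [[|[|[|//]]] i3].
- by rewrite (_ : Ordinal i3 = 0)//; exact: val_inj.
- by rewrite (_ : Ordinal i3 = 1)//; exact: val_inj.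
- by rewrite (_ : Ordinal i3 = 2)//; exact: val_inj.
Qed.

Lemma A243_mul (R : realType) (x : 'cV[R]_3) :
  [/\ (A243 R *m x) 0 0 = 10 * x 1 0 - 4 * x 2 0,
      (A243 R *m x) 1 0 = 10 * x 0 0 + 9 * x 1 0 - 6 * x 2 0
    & (A243 R *m x) 2 0 = 4 * x 0 0 + 2 * x 1 0 - 9 * x 2 0].
Proof.
have l1 : lift ord0 ord0 = 1 :> 'I_3 by exact: val_inj.
have l2 : lift ord0 (lift ord0 ord0) = 2 :> 'I_3 by exact: val_inj.
split; rewrite mxE !big_ord_recl big_ord0 l2 l1 !mxE /=.
- ring.
- ring.
- ring.
Qed.

Lemma vec3E (R : realType) (x y z : R) :
  [/\ vec3 x y z 0 0 = x, vec3 x y z 1 0 = y & vec3 x y z 2 0 = z].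
Proof. by rewrite !mxE. Qed.

Lemma A243_supported (R : realType) (J : {set 'I_3}) (l x y z : R) :
  (if 0 \in J then 10 * y - 4 * z = l * x else x = 0) ->
  (if 1 \in J then 10 * x + 9 * y - 6 * z = l * y else y = 0) ->
  (if 2 \in J then 4 * x + 2 * y - 9 * z = l * z else z = 0) ->
  supported_eigenvector (A243 R) J l (vec3 x y z).
Proof.
have [vx vy vz] := vec3E x y z; have := A243_mul (vec3 x y z).
rewrite vx vy vz => -[e0 e1 e2] h0 h1 h2.
split; apply: ord3P; rewrite ?e0 ?e1 ?e2 ?vx ?vy ?vz.
- by move: h0; case: ifP.
- by move: h1; case: ifP.
- by move: h2; case: ifP.
- by move: h0; case: ifP.
- by move: h1; case: ifP.
- by move: h2; case: ifP.
Qed.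

Lemma A243_regular (R : realType) (J : {set 'I_3}) (l x y z : R) :
  is_support J ->
  alg_simple_eigenvalue (submx_at (A243 R) J J) l ->
  supported_eigenvector (A243 R) J l (vec3 x y z) ->
  0 < (if 0 \in J then x else 10 * y - 4 * z) ->
  0 < (if 1 \in J then y else 10 * x + 9 * y - 6 * z) ->
  0 < (if 2 \in J then z else 4 * x + 2 * y - 9 * z) ->
  Pareto_eigenvalue (A243 R) l /\ regularly_produced (A243 R) J l.
Proof.
move=> J0 ls xl.
have [vx vy vz] := vec3E x y z; have := A243_mul (vec3 x y z).
rewrite vx vy vz => -[e0 e1 e2] h0 h1 h2.
have xJ i : i \in J -> 0 < vec3 x y z i 0.
  move: i; apply: ord3P; rewrite ?vx ?vy ?vz => iJ.
  - by rewrite iJ in h0.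
  - by rewrite iJ in h1.
  - by rewrite iJ in h2.
have xJc i : i \notin J -> 0 < (A243 R *m vec3 x y z) i 0.
  move: i; apply: ord3P; rewrite ?e0 ?e1 ?e2 => /negbTE iJ.
  - by rewrite iJ in h0.
  - by rewrite iJ in h1.
  - by rewrite iJ in h2.
split; first exact: Pareto_of_supported xl xJ xJc.
exact: produced_regular xl xJ xJc.
Qed.

(** The cases are the zero patterns of the vector. For supports of size at least two, the
    multipliers in the [ring] identities form, up to sign, the first row of the adjugate of
    [A_J - l]. Each of the two inequalities excludes the negative root of its quadratic. *)
Lemma Pareto_A243_poly (R : realType) (l : R) : Pareto_eigenvalue (A243 R) l ->
  l = 0 \/ l = 9 \/ (l ^+ 2 - 9 * l - 100 = 0 /\ 0 < l) \/
  l ^+ 2 + 9 * l + 16 = 0 \/ (l ^+ 2 - 69 = 0 /\ -6 <= l) \/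
  l ^+ 3 - 153 * l - 724 = 0.
Proof.
move=> [v [v0 v_ge0 w_ge0]].
have [e0 e1 e2] := A243_mul v.
have wE i : (A243 R *m v - l *: v) i 0 = (A243 R *m v) i 0 - l * v i 0.
  by rewrite !mxE.
have w0 := w_ge0 0; have w1 := w_ge0 1; have w2 := w_ge0 2.
rewrite wE e0 in w0; rewrite wE e1 in w1; rewrite wE e2 in w2.
(* A sum of nonnegative products is zero, so every product is zero. *)
move=> /psumr_eq0P vw.
have {}vw i : v i 0 * (A243 R *m v - l *: v) i 0 = 0.
  by apply: vw => // j _; rewrite mulr_ge0.
have c0 := vw 0; have c1 := vw 1; have c2 := vw 2.
rewrite wE e0 in c0; rewrite wE e1 in c1; rewrite wE e2 in c2.
have x0 := v_ge0 0; have y0 := v_ge0 1; have z0 := v_ge0 2.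
have v_neq0 : ~ (v 0 0 = 0 /\ v 1 0 = 0 /\ v 2 0 = 0).
  move=> [x00 [y00 z00]]; case/eqP: v0; apply/matrixP => i j.
  by rewrite (ord1 j) mxE; move: i; apply: ord3P.
clear - x0 y0 z0 c0 c1 c2 w0 w1 w2 v_neq0.
move: (v 0 0) (v 1 0) (v 2 0) x0 y0 z0 c0 c1 c2 w0 w1 w2 v_neq0 => x y z.
move=> x0 y0 z0 c0 c1 c2 w0 w1 w2 v_neq0.
have cancel (u t : R) : 0 < u -> u * t = 0 -> t = 0.
  by move=> u0 /eqP; rewrite mulf_eq0 gt_eqF//= => /eqP.
move: x0 y0 z0; rewrite !le_eqVlt.
move=> /orP[/eqP/esym xE|x0] /orP[/eqP/esym yE|y0] /orP[/eqP/esym zE|z0].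
- by case: v_neq0.
(* Row 1 would read [0 <= - 4 * z] with [z] positive. *)
- by exfalso; rewrite xE yE in w0; nra.
- right; left; move: (cancel _ _ y0 c1); rewrite xE zE => h.
  by apply/eqP; rewrite eq_sym -subr_eq0; apply/eqP/(cancel y) => //; lra.
- do 4 right; left; move: (cancel _ _ y0 c1) (cancel _ _ z0 c2).
  rewrite xE => h1 h2; rewrite xE in w0.
  split; last first.
    (* Row 2 gives [6 * z = (9 - l) * y]; row 1 then becomes [2/3 * y * (l + 6)]. *)
    have : 0 <= y * (l + 6) by lra.
    by rewrite pmulr_rge0//; lra.
  apply: (cancel _ _ y0).
  have -> : y * (l ^+ 2 - 69) =
    - (l + 9) * (10 * 0 + 9 * y - 6 * z - l * y)
    + 6 * (4 * 0 + 2 * y - 9 * z - l * z) by ring.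
  by rewrite h1 h2; ring.
- left; move: (cancel _ _ x0 c0); rewrite yE zE => h.
  by apply: (cancel x) => //; lra.
- do 3 right; left; move: (cancel _ _ x0 c0) (cancel _ _ z0 c2).
  rewrite yE => h1 h2; apply: (cancel _ _ x0).
  have -> : x * (l ^+ 2 + 9 * l + 16) =
    - (l + 9) * (10 * 0 - 4 * z - l * x)
    + 4 * (4 * x + 2 * 0 - 9 * z - l * z) by ring.
  by rewrite h1 h2; ring.
- do 2 right; left; move: (cancel _ _ x0 c0) (cancel _ _ y0 c1).
  rewrite zE => h1 h2; split; last first.
    by rewrite -(pmulr_lgt0 _ x0); lra.
  apply: (cancel _ _ x0).
  have -> : x * (l ^+ 2 - 9 * l - 100) =
    - (l - 9) * (10 * y - 4 * 0 - l * x)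
    - 10 * (10 * x + 9 * y - 6 * 0 - l * y) by ring.
  by rewrite h1 h2; ring.
- do 5 right; move: (cancel _ _ x0 c0) (cancel _ _ y0 c1) (cancel _ _ z0 c2).
  move=> h0 h1 h2; apply: (cancel _ _ x0).
  have -> : x * (l ^+ 3 - 153 * l - 724) =
    - (l ^+ 2 - 69) * (10 * y - 4 * z - l * x)
    - (10 * l + 82) * (10 * x + 9 * y - 6 * z - l * y)
    + (4 * l + 24) * (4 * x + 2 * y - 9 * z - l * z) by ring.
  by rewrite h0 h1 h2; ring.
Qed.

Lemma ivt_root (R : realType) (p : {poly R}) (a b : R) :
  a < b -> p.[a] * p.[b] < 0 -> exists2 r, a < r < b & p.[r] = 0.
Proof.
move=> ab; wlog pa : p / p.[a] < 0 => [hwlog|] pab.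
  have [pa|pa|pa] := ltgtP p.[a] 0; first exact: hwlog.
    have [||r rab] := hwlog (- p).
    - by rewrite hornerN oppr_lt0.
    - by rewrite !hornerN mulrNN.
    by rewrite hornerN => /eqP; rewrite oppr_eq0 => /eqP; exists r.
  by move: pab; rewrite pa mul0r ltxx.
have pb : 0 < p.[b] by rewrite -(nmulr_rlt0 _ pa).
have [|r /andP[ar rb] /eqP pr] := @poly_ivt R p a b (ltW ab).
  by rewrite (ltW pa) (ltW pb).
(* The root is interior: [p] is nonzero at both endpoints. *)
exists r => //; rewrite !lt_neqAle ar rb !andbT.
by apply/andP; split; apply/eqP => e; move: pa pb;
  rewrite ?e ?pr -?e ?pr ltxx.
Qed.

(** * Finite tables for supports and assigned maps *)

(** Boolean triples can be compared and counted by computation, unlike sets. *)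
Definition support3 (b : bool * bool * bool) : {set 'I_3} :=
  [set i : 'I_3 | nth false [:: b.1.1; b.1.2; b.2] i]%SET.

Lemma support3E (b : bool * bool * bool) :
  [/\ (0 \in support3 b) = b.1.1, (1 \in support3 b) = b.1.2
    & (2 \in support3 b) = b.2].
Proof. by rewrite !inE. Qed.

Lemma support3_inj : injective support3.
Proof.
move=> [[a b] c] [[a' b'] c'] e.
have [] := support3E (a, b, c); rewrite e.
by have [-> -> ->] := support3E (a', b', c') => /= -> -> ->.
Qed.

Lemma card_support3 (b : bool * bool * bool) :
  #|support3 b| = (b.1.1 + b.1.2 + b.2)%N.
Proof.
rewrite -sum1_card big_mkcond !big_ord_recl big_ord0 !inE /=.
by case: b => -[[] []] [].
Qed.

(* Outside the keys of the table, index is out of range and the value is k0. *)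
Definition table_map (T : eqType) (K : Type) (k0 : K) (t : seq (T * K))
    (l : T) : K :=
  nth k0 (unzip2 t) (index l (unzip1 t)).

Lemma table_mapE (T K : eqType) (k0 : K) (t : seq (T * K)) p :
  uniq (unzip1 t) -> p \in t -> table_map k0 t p.1 = p.2.
Proof.
move=> ut pt; pose i := index p t.
have it : (i < size t)%N by rewrite index_mem.
have pE : p = nth p t i by rewrite nth_index.
rewrite /table_map [in p.1]pE -(nth_map _ p.1 fst)//.
rewrite index_uniq ?size_map// (nth_map p)//.
by rewrite -pE.
Qed.

(** As keys are distinct, the eigenvalues assigned to [supp k] are the keys of the rows labelled
    [k], each listed once. *)
Lemma support_count_table (R : realType) (n : nat) (A : 'M[R]_n) (K : eqType)
    (supp : K -> {set 'I_n}) (k0 : K) (t : seq (R * K)) (k : K) :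
  injective supp -> uniq (unzip1 t) ->
  (forall l, Pareto_eigenvalue A l <-> l \in unzip1 t) ->
  support_count A (supp \o table_map k0 t) (supp k) (count_mem k (unzip2 t)).
Proof.
move=> supp_inj ut At; rewrite /support_count count_map.
pose s := unzip1 [seq p <- t | p.2 == k].
have -> : count (preim snd (pred1 k)) t = size s.
  by rewrite size_map size_filter.
have -> : [set l | Pareto_spectrum A l /\ (supp \o table_map k0 t) l = supp k]
    = [set l | l \in s].
  apply/seteqP; split => l /=.
    move=> [/At/mapP[p pt ->] /supp_inj]; rewrite table_mapE// => pk.
    by apply/mapP; exists p => //; rewrite mem_filter pk eqxx.
  move=> /mapP[p]; rewrite mem_filter => /andP[/eqP pk pt] ->.
  split; last by rewrite table_mapE// pk.
  by apply/At/mapP; exists p.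
apply: card_eq_uniq_seq; apply: subseq_uniq ut.
exact/map_subseq/filter_subseq.
Qed.

(** * Roots located by sign changes *)

Lemma quadratic_root (R : realType) (p q a b : R) : a < b ->
  (a ^+ 2 + p * a + q) * (b ^+ 2 + p * b + q) < 0 ->
  exists2 r, a < r < b & r ^+ 2 + p * r + q = 0.
Proof.
move=> ab h; have [|r rab hr] := @ivt_root R ('X^2 + p *: 'X + q%:P) a b ab.
  by rewrite !hornerE.
by exists r => //; rewrite !hornerE in hr.
Qed.

Lemma cubic_root (R : realType) (p q a b : R) : a < b ->
  (a ^+ 3 + p * a + q) * (b ^+ 3 + p * b + q) < 0 ->
  exists2 r, a < r < b & r ^+ 3 + p * r + q = 0.
Proof.
move=> ab h; have [|r rab hr] := @ivt_root R ('X^3 + p *: 'X + q%:P) a b ab.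
  by rewrite !hornerE.
by exists r => //; rewrite !hornerE in hr.
Qed.

(* s lists all the eigenvalues of A_J, and f m is an eigenvector for m extended
   by zero; only the one for l has to be positive on J. *)
Lemma A243_regular_of_spectrum (R : realType) (b : bool * bool * bool)
    (s : seq R) (l : R) (f : R -> R * R * R) :
  let x m := (f m).1.1 in let y m := (f m).1.2 in let z m := (f m).2 in
  uniq s -> size s = (b.1.1 + b.1.2 + b.2)%N ->
  (forall m, m \in s ->
    [/\ (if b.1.1 then 10 * y m - 4 * z m = m * x m else x m = 0),
        (if b.1.2 then 10 * x m + 9 * y m - 6 * z m = m * y m else y m = 0),
        (if b.2 then 4 * x m + 2 * y m - 9 * z m = m * z m else z m = 0)
      & (if b.1.1 then x m != 0 else if b.1.2 then y m != 0 else false)]) ->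
  l \in s ->
  0 < (if b.1.1 then x l else 10 * y l - 4 * z l) ->
  0 < (if b.1.2 then y l else 10 * x l + 9 * y l - 6 * z l) ->
  0 < (if b.2 then z l else 4 * x l + 2 * y l - 9 * z l) ->
  Pareto_eigenvalue (A243 R) l /\ regularly_produced (A243 R) (support3 b) l.
Proof.
move=> x y z us sb eig ls h0 h1 h2.
have [b0 b1 b2] := support3E b.
have sup m : m \in s ->
    supported_eigenvector (A243 R) (support3 b) m (vec3 (x m) (y m) (z m)).
  by move=> /eig[? ? ? _]; apply: A243_supported; rewrite ?b0 ?b1 ?b2.
(* The support has [size s] elements, and [s] contains [l]. *)
have J0 : is_support (support3 b).
  rewrite /is_support -card_gt0 card_support3 -sb lt0n size_eq0.
  by apply: contraTneq ls => ->.
apply: (A243_regular (x := x l) (y := y l) (z := z l)) => //;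
  rewrite ?b0 ?b1 ?b2//; last exact: sup.
apply: (alg_simple_eigenvalue_uniq us _ _ ls); first by rewrite card_support3.
move=> m ms; exists (vec3 (x m) (y m) (z m)); split; first exact: sup.
have [vx vy vz] := vec3E (x m) (y m) (z m).
have [_ _ _] := eig m ms.
case: ifP => [b11 xm|_]; first by exists 0; rewrite ?b0 ?vx.
by case: ifP => // b12 ym; exists 1; rewrite ?b1 ?vy.
Qed.

(** * Regular production on each of the six occurring supports *)

Lemma A243_regular_1 (R : realType) : Pareto_eigenvalue (A243 R) 0 /\
  regularly_produced (A243 R) (support3 (true, false, false)) 0.
Proof.
apply: (@A243_regular_of_spectrum R _ [:: 0] 0 (fun m => (1, 0, 0))) => //;
  try (move=> /=; lra); last by rewrite mem_head.
by move=> m; rewrite inE => /eqP-> /=; rewrite oner_eq0; split => //; ring.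
Qed.

Lemma A243_regular_2 (R : realType) : Pareto_eigenvalue (A243 R) 9 /\
  regularly_produced (A243 R) (support3 (false, true, false)) 9.
Proof.
apply: (@A243_regular_of_spectrum R _ [:: 9] 9 (fun m => (0, 1, 0))) => //;
  try (move=> /=; lra); last by rewrite mem_head.
by move=> m; rewrite inE => /eqP-> /=; rewrite oner_eq0; split => //; ring.
Qed.

Lemma A243_regular_12 (R : realType) (a : R) : 9 < a ->
  a ^+ 2 + -9 * a + -100 = 0 -> Pareto_eigenvalue (A243 R) a /\
  regularly_produced (A243 R) (support3 (true, true, false)) a.
Proof.
move=> a_gt aE.
(* The roots sum to 9, and row 1 reads [10 * y = m * x]. *)
apply: (@A243_regular_of_spectrum R _ [:: 9 - a; a] a
  (fun m => (10, m, 0))) => //=.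
- by rewrite andbT inE; apply/eqP; lra.
- move=> m ms; have mE : m ^+ 2 = 9 * m + 100.
    by move: ms; rewrite !inE => /orP[]/eqP->; lra.
  by clear a_gt aE ms; split; lra.
- by rewrite !inE eqxx orbT.
- by lra.
- by lra.
Qed.

(** Row 1 gives the vector [(4, 0, - m)], positive on the support for [m < 0]. Row 2 takes the value
    [40 + 6 * m] on it, whence the bound [-20/3]. *)
Lemma A243_regular_13 (R : realType) (b b' m : R) :
  -20/3 < b -> b < b' -> b' < 0 ->
  b ^+ 2 + 9 * b + 16 = 0 -> b' ^+ 2 + 9 * b' + 16 = 0 ->
  m \in [:: b; b'] -> Pareto_eigenvalue (A243 R) m /\
  regularly_produced (A243 R) (support3 (true, false, true)) m.
Proof.
move=> b_gt bb' b'_lt bE b'E ms.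
have mb : -20/3 < m < 0.
  move: ms; rewrite !inE => /orP[]/eqP->.
    by rewrite b_gt (lt_trans bb').
  by rewrite b'_lt (lt_trans b_gt).
move: mb => /andP[m_gt m_lt].
apply: (@A243_regular_of_spectrum R _ [:: b; b'] m
  (fun m => (4, 0, - m))) => //.
- by rewrite /= andbT inE lt_eqF.
- move=> k ks; have kE : k ^+ 2 + 9 * k + 16 = 0.
    by move: ks; rewrite !inE => /orP[]/eqP->.
  by clear -kE; split=> //=; lra.
- by clear -m_gt => /=; lra.
- by clear -m_lt => /=; lra.
Qed.

Lemma A243_regular_23 (R : realType) (c : R) : 0 < c -> c < 9 ->
  c ^+ 2 + 0 * c + -69 = 0 -> Pareto_eigenvalue (A243 R) c /\
  regularly_produced (A243 R) (support3 (false, true, true)) c.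
Proof.
move=> c_gt c_lt cE.
(* Row 2 gives [6 * z = (9 - m) * y]. Row 1 takes the value [24 + 4 * c] at [m = c]. *)
apply: (@A243_regular_of_spectrum R _ [:: - c; c] c
  (fun m => (0, 6, 9 - m))) => //=.
- by rewrite andbT inE; apply/eqP; lra.
- move=> m ms; have mE : m ^+ 2 = 69.
    by move: ms; rewrite !inE => /orP[]/eqP->; lra.
  by clear c_gt c_lt cE ms; split; lra.
- by rewrite !inE eqxx orbT.
- by lra.
- by lra.
Qed.

(** The bounds make the eigenvector positive: [-40 - 6 * k] is positive exactly below [-20/3], and
    [100 + 9 * k - k ^+ 2] is positive between 14 and 15. *)
Lemma A243_regular_123 (R : realType) (d d' e m : R) :
  d < d' -> d' < -20/3 -> 14 < e -> e < 15 ->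
  d ^+ 3 + -153 * d + -724 = 0 -> d' ^+ 3 + -153 * d' + -724 = 0 ->
  e ^+ 3 + -153 * e + -724 = 0 ->
  m \in [:: d; d'; e] -> Pareto_eigenvalue (A243 R) m /\
  regularly_produced (A243 R) (support3 (true, true, true)) m.
Proof.
move=> dd' d'_lt e_gt e_lt dE d'E eE ms.
have de : d' < e by clear -d'_lt e_gt; lra.
have bound k : k \in [:: d; d'; e] -> k < -20/3 \/ 14 < k < 15.
  rewrite !inE => /or3P[]/eqP->; first by left; exact: lt_trans d'_lt.
    by left.
  by right; rewrite e_gt.
(* Cross product of rows 1 and 2 of A - k, up to sign. *)
pose f (k : R) : R * R * R :=
  if k < 0 then (-24 - 4 * k, -40 - 6 * k, k ^+ 2 - 9 * k - 100)
  else (24 + 4 * k, 40 + 6 * k, 100 + 9 * k - k ^+ 2).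
have f_gt0 k : k \in [:: d; d'; e] -> [/\ 0 < (f k).1.1, 0 < (f k).1.2 & 0 < (f k).2].
  move=> /bound; rewrite /f; clear => -[k_lt|/andP[k_gt k_lt]].
    have -> : k < 0 by lra.
    by split => /=; [lra|lra|nra].
  have -> : (k < 0) = false by apply/negbTE; rewrite -leNgt; lra.
  by split => /=; [lra|lra|nra].
have [fx fy fz] := f_gt0 _ ms.
apply: (@A243_regular_of_spectrum R _ [:: d; d'; e] m f) => //.
- by rewrite /= !inE negb_or !lt_eqF// (lt_trans dd').
- move=> k ks; have kE : k ^+ 3 + -153 * k + -724 = 0.
    by move: ks; rewrite !inE => /or3P[]/eqP->.
  have [fk _ _] := f_gt0 _ ks; rewrite /= gt_eqF//.
  clear -kE; rewrite /f; case: ifP => _ /=; split=> //; lra.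
Qed.

(** * Completeness of the lists of roots *)

(** Subtracting the equations of [u] and [v] gives [u + v + p = 0], which turns the difference of
    those of [w] and [u] into [(w - u) * (w - v) = 0]. *)
Lemma quadratic_roots (R : idomainType) (p q u v w : R) : u != v ->
  u ^+ 2 + p * u + q = 0 -> v ^+ 2 + p * v + q = 0 ->
  w ^+ 2 + p * w + q = 0 -> (w == u) || (w == v).
Proof.
move=> uv uE vE wE.
have pE : u + v + p = 0.
  move: uv; rewrite -subr_eq0 => uv; apply: (mulfI uv); rewrite mulr0.
  transitivity ((u ^+ 2 + p * u + q) - (v ^+ 2 + p * v + q)); first by ring.
  by rewrite uE vE subr0.
rewrite -(subr_eq0 w u) -(subr_eq0 w v) -mulf_eq0; apply/eqP.
transitivity ((w ^+ 2 + p * w + q) - (u ^+ 2 + p * u + q)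
  - (w - u) * (u + v + p)); first by ring.
by rewrite wE uE pE mulr0 !subr0.
Qed.

(* Dividing x^3 + p x + q by x - u leaves x^2 + u x + (u^2 + p). *)
Lemma depressed_cubic_roots (R : idomainType) (p q u v w t : R) :
  u != v -> u != w -> v != w ->
  u ^+ 3 + p * u + q = 0 -> v ^+ 3 + p * v + q = 0 ->
  w ^+ 3 + p * w + q = 0 -> t ^+ 3 + p * t + q = 0 ->
  [|| t == u, t == v | t == w].
Proof.
move=> uv uw vw uE vE wE tE.
have quot x : x != u -> x ^+ 3 + p * x + q = 0 ->
    x ^+ 2 + u * x + (u ^+ 2 + p) = 0.
  rewrite -subr_eq0 => xu xE; apply: (mulfI xu); rewrite mulr0.
  transitivity ((x ^+ 3 + p * x + q) - (u ^+ 3 + p * u + q)); first by ring.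
  by rewrite xE uE subr0.
have [//|tu] := eqVneq t u.
by apply: (quadratic_roots vw); apply: quot => //; rewrite eq_sym.
Qed.

(** The keys are listed in increasing order, so sortedness proves them distinct. The labels are
    explicit so that their multiplicities compute. *)
Lemma A243_table (R : realType) :
  exists t : seq (R * (bool * bool * bool)),
  [/\ uniq (unzip1 t),
      unzip2 t = [:: (true, true, true); (true, true, true);
        (true, false, true); (true, false, true); (true, false, false);
        (false, true, true); (false, true, false); (true, true, true);
        (true, true, false)],
      forall p, p \in t -> Pareto_eigenvalue (A243 R) p.1 /\
        regularly_produced (A243 R) (support3 p.2) p.1
    & forall l, Pareto_eigenvalue (A243 R) l -> l \in unzip1 t].
Proof.
have [||a /andP[a_gt a_lt] aE] := @quadratic_root R (-9) (-100) 15 16.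
- by lra.
- by lra.
have [||b /andP[b_gt b_lt] bE] := @quadratic_root R 9 16 (-20/3) (-6).
- by clear; lra.
- by clear; lra.
have [||b' /andP[b'_gt b'_lt] b'E] := @quadratic_root R 9 16 (-3) (-2).
- by clear; lra.
- by clear; lra.
have [||c /andP[c_gt c_lt] cE] := @quadratic_root R 0 (-69) 8 9.
- by clear; lra.
- by clear; lra.
have [||d /andP[d_gt d_lt] dE] := @cubic_root R (-153) (-724) (-8) (-7).
- by clear; lra.
- by clear; lra.
(* Both [d'] and [b] lie between -7 and -6; the point [-20/3] separates them and is the bound needed
   for positivity in both cases. *)
have [||d' /andP[d'_gt d'_lt] d'E] :=
  @cubic_root R (-153) (-724) (-7) (-20/3).
- by clear; lra.
- by clear; lra.
have [||e /andP[e_gt e_lt] eE] := @cubic_root R (-153) (-724) 14 15.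
- by clear; lra.
- by clear; lra.
have dd' : d < d' by exact: lt_trans d'_gt.
have d'b : d' < b by exact: lt_trans b_gt.
have bb' : b < b' by clear -b_lt b'_gt; lra.
have b'0 : b' < 0 by clear -b'_lt; lra.
have c0 : 0 < c by clear -c_gt; lra.
have e9 : 9 < e by clear -e_gt; lra.
have a9 : 9 < a by clear -a_gt; lra.
have ea : e < a by exact: lt_trans a_gt.
exists [:: (d, (true, true, true)); (d', (true, true, true));
  (b, (true, false, true)); (b', (true, false, true));
  (0, (true, false, false)); (c, (false, true, true));
  (9, (false, true, false)); (e, (true, true, true));
  (a, (true, true, false))].
split=> //.
- apply: lt_sorted_uniq => /=.
  by rewrite dd' d'b bb' b'0 c0 c_lt e9 ea.
- have h123 m := @A243_regular_123 R d d' e m dd' d'_lt e_gt e_lt dE d'E eE.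
  have h13 m := @A243_regular_13 R b b' m b_gt bb' b'0 bE b'E.
  move=> p; rewrite !inE.
  move=> /orP[/eqP->|/orP[/eqP->|/orP[/eqP->|/orP[/eqP->|]]]];
    last move=> /orP[/eqP->|/orP[/eqP->|/orP[/eqP->|/orP[/eqP->|/eqP->]]]].
  + by apply: h123; rewrite !inE eqxx.
  + by apply: h123; rewrite !inE eqxx orbT.
  + by apply: h13; rewrite !inE eqxx.
  + by apply: h13; rewrite !inE eqxx orbT.
  + exact: A243_regular_1.
  + exact: A243_regular_23.
  + exact: A243_regular_2.
  + by apply: h123; rewrite !inE eqxx !orbT.
  + exact: A243_regular_12.
- move=> l /Pareto_A243_poly; rewrite /= !inE.
  move=> [->|[->|[[lE l0]|[lE|[[lE l6]|lE]]]]].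
  + by rewrite eqxx !orbT.
  + by rewrite eqxx !orbT.
  (* The second root [9 - a] is negative, against [0 < l]. *)
  + have aN : a != 9 - a by clear -a9; apply/eqP; lra.
    have a'E : (9 - a) ^+ 2 + -9 * (9 - a) + -100 = 0 by clear -aE; lra.
    have lE' : l ^+ 2 + -9 * l + -100 = 0 by clear -lE; lra.
    have /orP[->|/eqP la] := quadratic_roots aN aE a'E lE'.
      by rewrite !orbT.
    have : l <= 0 by clear -la a9; lra.
    by rewrite leNgt l0.
  + have bNb' : b != b' by rewrite lt_eqF.
    by have /orP[->|->] := quadratic_roots bNb' bE b'E lE;
      rewrite /= !orbT.
  (* The second root [- c] is below -8, against [-6 <= l]. *)
  + have cN : c != - c by clear -c0; apply/eqP; lra.
    have c'E : (- c) ^+ 2 + 0 * (- c) + -69 = 0 by clear -cE; lra.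
    have lE' : l ^+ 2 + 0 * l + -69 = 0 by clear -lE; lra.
    have /orP[->|/eqP lc] := quadratic_roots cN cE c'E lE'.
      by rewrite /= !orbT.
    have : l < -6 by clear -lc c_gt; lra.
    by rewrite ltNge l6.
  + have lE' : l ^+ 3 + -153 * l + -724 = 0 by clear -lE; lra.
    have de : d' < e by clear -d'_lt e_gt; lra.
    have [dNd' dNe d'Ne] : [/\ d != d', d != e & d' != e].
      by rewrite !lt_eqF//; exact: lt_trans de.
    have := depressed_cubic_roots dNd' dNe d'Ne dE d'E eE lE'.
    by case/or3P => ->; rewrite /= ?orbT.
Qed.

Theorem proposition6p3 (R : realType) :
  ([set l : R | regular_Pareto_eigenvalue (A243 R) l] #= `I_9)%card /\
  exists tau : R -> {set 'I_3},
    assigned_support_map (A243 R) tau /\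
    detailed_profile (A243 R) tau 1 1 0 1 2 1 3.
Proof.
have [t [ut t2 tP Pt]] := A243_table R.
have At l : Pareto_eigenvalue (A243 R) l <-> l \in unzip1 t.
  by split=> [/Pt//|/mapP[p /tP[Pp _] ->]].
split.
  have -> : [set l : R | regular_Pareto_eigenvalue (A243 R) l]
      = [set l | l \in unzip1 t].
    apply/seteqP; split => l /=; first by move=> [/At].
    move=> /mapP[p /tP[Pp rp] ->]; split=> //.
    by exists (support3 p.2).
  have := card_eq_uniq_seq ut.
  by rewrite size_map -(size_map snd) -/(unzip2 t) t2.
(* This default encodes the empty set and is reached only off the Pareto spectrum. *)
pose k0 := (false, false, false).
exists (support3 \o table_map k0 t); split.
  move=> l /At/mapP[p pt ->]; rewrite /= table_mapE//.
  have [_ [_ [u [pu _]]]] := tP _ pt.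
  by split; [case: pu|exists u].
(* Each literal set of the profile is matched with its triple, so its count is read off the labels;
   [{3}] labels no row. *)
have cntE (J : {set 'I_3}) b : (0 \in J) = b.1.1 -> (1 \in J) = b.1.2 ->
    (2 \in J) = b.2 ->
    support_count (A243 R) (support3 \o table_map k0 t) J
      (count_mem b (unzip2 t)).
  move=> J0 J1 J2; suff -> : J = support3 b.
    exact: support_count_table support3_inj ut At.
  have [b0 b1 b2] := support3E b.
  by apply/setP; apply: ord3P; rewrite ?J0 ?J1 ?J2.
rewrite t2 in cntE.
split; [split|split|].
- by apply: (cntE _ (true, false, false)); rewrite !inE.
- by apply: (cntE _ (false, true, false)); rewrite !inE.
- by apply: (cntE _ (false, false, true)); rewrite !inE.
- by apply: (cntE _ (true, true, false)); rewrite !inE.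
- by apply: (cntE _ (true, false, true)); rewrite !inE.
- by apply: (cntE _ (false, true, true)); rewrite !inE.
- by apply: (cntE _ (true, true, true)); rewrite !inE.
Qed.
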